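(* Let $i\in\{2,3\}$. The final co-algebra of $F_i$ on $\mathbf{MS}_i^{C}$ is the same as that of $F_i$ on $\mathbf{MS}_i^{S}$; that is, the final co-algebra $(S_i,\psi_i)$ of $F_i$ on $\mathbf{MS}_i^{S}$ is also a final co-algebra of $F_i$ on $\mathbf{MS}_i^{C}$.
   Context: **Pointed sets and metric spaces.** A bi-pointed set is $(X,\top,\bot)$, a set with two distinguished elements; a tri-pointed set is $(X,T,L,R)$, a set with three distinguished elements. $\mathbf{Set}_i$ ($i=2,3$) is the category of $i$-pointed sets and functions preserving the distinguished elements. An $i$-pointed metric space is an $i$-pointed set with a metric $d\le 1$ such that distinct distinguished elements are at distance $1$. $\mathbf{MS}_i^{S}$ and $\mathbf{MS}_i^{C}$ are the categories of $i$-pointed metric spaces with, respectively, short maps (i.e. $1$-Lipschitz maps) and continuous maps preserving the distinguished elements. **The functors.** $M_2=\{l,r\}$, $M_3=\{a,b,c\}$. $M_2\otimes X$ is the quotient of $M_2\times X$ by the equivalence relation generated by $(l,\top)\sim(r,\bot)$, with $\bot_{M_2\otimes X}=l\otimes\bot$, $\top_{M_2\otimes X}=r\otimes\top$. $M_3\otimes X$ is the quotient of $M_3\times X$ by the equivalence relation generated by $(b,T)\sim(a,L)$, $(a,R)\sim(c,T)$, $(c,L)\sim(b,R)$, with distinguished elements $T=a\otimes T$, $L=b\otimes L$, $R=c\otimes R$. Here $m\otimes x$ is the class of $(m,x)$. Put $F_iX=M_i\otimes X$ and $F_if=M_i\otimes f$, $(M_i\otimes f)(m\otimes x)=m\otimes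 f(x)$. If $X$ is an $i$-pointed metric space, $M_i\times X$ has the metric equal to $\frac12 d(x,y)$ between $(m,x),(m,y)$ and $1$ between $(m,x),(n,y)$ with $m\ne n$, and $M_i\otimes X$ carries the quotient metric. Explicitly $d(m\otimes x,m\otimes y)=\frac12 d(x,y)$; for $i=2$, $d(l\otimes x,r\otimes y)=\frac12(d(x,\top)+d(\bot,y))$; for $i=3$, $d(a\otimes x,b\otimes y)=\frac12\min\{d(x,L)+d(T,y),\,d(x,R)+1+d(R,y)\}$, $d(a\otimes x,c\otimes y)=\frac12\min\{d(x,R)+d(T,y),\,d(x,L)+1+d(L,y)\}$, $d(b\otimes x,c\otimes y)=\frac12\min\{d(x,R)+d(L,y),\,d(x,T)+1+d(T,y)\}$. This makes $F_i$ an endofunctor on each of these categories. **Co-algebras.** An $F_i$ co-algebra is an object $X$ with a morphism $e:X\to M_i\otimes X$ of the category; a morphism $(X,e)\to(Y,e')$ is a morphism $f:X\to Y$ with $e'\circ f=(M_i\otimes f)\circ e$; a final co-algebra is a terminal object in the category of co-algebras. **The co-algebra $(S_i,\psi_i)$.** Let $I$ be the initial object (the set of $i$ distinguished points, at mutual distance $1$) and $!:I\to M_i\otimes I$ the unique morphism. $G_i$ is the colimit of the chain of isometric embeddings $I\to M_i\otimes I\to M_i^2\otimes I\to\cdots$ with maps $M_i^n\otimes !$, where $M_i^{n+1}\otimes I=M_i\otimes(M_i^n\otimes I)$; its elements are classes $[m_1\otimes\cdots\otimes m_k\otimes d]$ with $m_j\in M_i$, $d\in I$. The map $g_i:M_i\otimes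 G_i\to G_i$, $g_i(m\otimes[x])=[m\otimes x]$, is an isometric bijection. $S_i$ is the Cauchy completion of $G_i$, and $\psi_i:S_i\to M_i\otimes S_i$ is the continuous extension of $g_i^{-1}$, so $\psi_i([m_1\otimes m_2\otimes\cdots\otimes m_k\otimes d])=m_1\otimes[m_2\otimes\cdots\otimes m_k\otimes d]$. It is known that $(S_i,\psi_i)$ is the final co-algebra of $F_i$ on $\mathbf{MS}_i^{S}$ and, after forgetting the metric, on $\mathbf{Set}_i$. *)

(* Defs.v *)
From HB Require Import structures.
From Stdlib Require Import Relation_Operators.
From mathcomp Require Import all_boot all_order all_algebra.
From mathcomp Require Import generic_quotient lra.
From mathcomp Require Import all_classical all_reals.
From mathcomp Require Import topology normedtype sequences.

Set Implicit Arguments.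
Unset Strict Implicit.
Unset Printing Implicit Defensive.

Import Order.TTheory GRing.Theory Num.Theory.
Import numFieldNormedType.Exports.
Local Open Scope classical_set_scope.
Local Open Scope ring_scope.
Local Open Scope quotient_scope.

Section QuotientMetric.
Context {R : realType} {T : choiceType}.

Record is_quotient_metric (e : equiv_rel T) (d : T -> T -> R) : Prop := {
  qm_sym : forall p q, d p q = d q p;
  qm_triangle : forall q p r, d p r <= d p q + d q r;
  qm_eq0 : forall p q, e p q <-> d p q = 0 }.

(* The set-theoretic quotient T / e, with the metric induced by the
   pseudometric d whose null pairs are exactly the pairs related by e. *)
Definition quotient_by e d of is_quotient_metric e d := {eq_quot e}.

Variables (e : equiv_rel T) (d : T -> T -> R) (H : is_quotient_metric e d).

HB.instance Definition _ := Choice.on (quotient_by H).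
HB.instance Definition _ := EqQuotient.on (quotient_by H).

Definition quotient_dist (x y : quotient_by H) : R := d (repr x) (repr y).

Lemma qm_ge0 p q : 0 <= d p q.
Proof.
have dpp : d p p = 0 by apply/(qm_eq0 H); apply: equiv_refl.
have := qm_triangle H q p p; rewrite dpp (qm_sym H q p) -mulr2n.
by rewrite pmulrn_lge0.
Qed.

Lemma qm_compat p p' q q' : e p p' -> e q q' -> d p q = d p' q'.
Proof.
move=> /(qm_eq0 H) pp' /(qm_eq0 H) qq'.
have := qm_triangle H p' p q; have := qm_triangle H q' p' q.
have := qm_triangle H p p' q'; have := qm_triangle H q p q'.
rewrite (qm_sym H p' p) (qm_sym H q' q) pp' qq' !addr0 !add0r => a b c d'.
by apply/eqP; rewrite eq_le (le_trans d' c) (le_trans b a).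
Qed.

Lemma repr_equiv p : e (repr (\pi_(quotient_by H) p)) p.
Proof. by rewrite -eqmodE; apply/eqP; rewrite reprK. Qed.

Lemma quotient_distE p q :
  quotient_dist (\pi_(quotient_by H) p) (\pi_(quotient_by H) q) = d p q.
Proof. by apply: qm_compat; exact: repr_equiv. Qed.

Lemma quotient_dist_xx x : quotient_dist x x = 0.
Proof. by apply/(qm_eq0 H); apply: equiv_refl. Qed.

Lemma quotient_dist_eq0 x y : quotient_dist x y = 0 -> x = y.
Proof.
move=> /(qm_eq0 H) exy; rewrite -(reprK x) -(reprK y).
by apply/eqP; rewrite eqmodE.
Qed.

Lemma quotient_dist_sym x y : quotient_dist x y = quotient_dist y x.
Proof. exact: (qm_sym H). Qed.

Lemma quotient_dist_triangle y x z :
  quotient_dist x z <= quotient_dist x y + quotient_dist y z.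
Proof. exact: (qm_triangle H). Qed.

HB.instance Definition _ := @isMetric.Build R (quotient_by H)
  quotient_dist quotient_dist_xx quotient_dist_eq0
  quotient_dist_sym quotient_dist_triangle.

Lemma mdist_pi p q :
  mdist (\pi_(quotient_by H) p) (\pi_(quotient_by H) q) = d p q.
Proof. exact: quotient_distE. Qed.

End QuotientMetric.

Record pointedMetric (R : realType) (i : nat) := PointedMetric {
  pm_car :> metricType R;
  pt : 'I_i -> pm_car;
  pm_le1 : forall x y : pm_car, mdist x y <= 1;
  pm_pt : forall j k, j != k -> mdist (pt j) (pt k) = 1 }.

(* Both M_i and the set of distinguished points are indexed by 'I_i:
     i = 2:  l = 0, r = 1         and  \bot = pt 0, \top = pt 1;
     i = 3:  a = 0, b = 1, c = 2  and  T = pt 0, L = pt 1, R = pt 2.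
   With this indexing the gluings (l, \top) ~ (r, \bot), respectively
   (b, T) ~ (a, L), (a, R) ~ (c, T), (c, L) ~ (b, R), all have the form
   (m, pt n) ~ (n, pt m) with m != n, and the m-th distinguished point of
   M_i (x) X is m (x) pt m. *)
Section Tensor.
Context {R : realType} {i : nat}.

Section TensorSpace.
Variable X : pointedMetric R i.

Variant glue : 'I_i * X -> 'I_i * X -> Prop :=
  Glue m n : m != n -> glue (m, pt X n) (n, pt X m).

Definition glue_equiv (p q : 'I_i * X) : bool :=
  `[< clos_refl_sym_trans _ glue p q >].

Lemma glue_equiv_refl : reflexive glue_equiv.
Proof. by move=> p; apply/asboolP; exact: rst_refl. Qed.

Lemma glue_equiv_sym : symmetric glue_equiv.
Proof.
by move=> p q; apply/asboolP/asboolP => h; exact: rst_sym.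
Qed.

Lemma glue_equiv_trans : transitive glue_equiv.
Proof.
move=> q p r /asboolP pq /asboolP qr; apply/asboolP.
exact: rst_trans pq qr.
Qed.

Canonical glue_equiv_rel :=
  EquivRel glue_equiv glue_equiv_refl glue_equiv_sym glue_equiv_trans.

(* For m != n: the two cells touch at (m, pt n) ~ (n, pt m); alternatively one
   may cross a third cell k, entering at (k, pt m) and leaving at (k, pt n). *)
Definition tensor_pre_dist (p q : 'I_i * X) : R :=
  let: (m, x) := p in let: (n, y) := q in
  2^-1 * if m == n then mdist x y else
    \big[Num.min/mdist x (pt X n) + mdist (pt X m) y]_(k | (k != m) && (k != n))
      (mdist x (pt X k) + 1 + mdist (pt X k) y).

Local Notation tpd := tensor_pre_dist.

Lemma tpd_same m x y : tpd (m, x) (m, y) = 2^-1 * mdist x y.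
Proof. by rewrite /= eqxx. Qed.

Lemma tpd_direct m n x y : m != n ->
  tpd (m, x) (n, y) <= 2^-1 * (mdist x (pt X n) + mdist (pt X m) y).
Proof.
by move=> /negbTE mn; rewrite /= mn ler_pM2l ?invr_gt0//; exact: bigmin_le_id.
Qed.

Lemma tpd_via m n k x y : m != n -> k != m -> k != n ->
  tpd (m, x) (n, y) <= 2^-1 * (mdist x (pt X k) + 1 + mdist (pt X k) y).
Proof.
move=> /negbTE mn km kn; rewrite /= mn ler_pM2l ?invr_gt0//.
by apply: bigmin_le_cond; rewrite km.
Qed.

Variant tpd_spec (m n : 'I_i) (x y : X) : R -> Prop :=
| TpdDirect : tpd_spec m n x y (2^-1 * (mdist x (pt X n) + mdist (pt X m) y))
| TpdVia k of k != m & k != n :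
    tpd_spec m n x y (2^-1 * (mdist x (pt X k) + 1 + mdist (pt X k) y)).

Lemma tpdP m n x y : m != n -> tpd_spec m n x y (tpd (m, x) (n, y)).
Proof.
move=> mn; set d := tpd _ _.
have [|[k /andP[km kn] h]] : 2^-1 * (mdist x (pt X n) + mdist (pt X m) y) <= d \/
  exists2 k, (k != m) && (k != n) &
    2^-1 * (mdist x (pt X k) + 1 + mdist (pt X k) y) <= d.
- rewrite /d /= (negbTE mn).
  set b := \big[_/_]_(_ | _) _.
  have /bigmin_leP[h|[k kP h]] : b <= b by [].
    by left; rewrite ler_pM2l ?invr_gt0.
  by right; exists k => //; rewrite ler_pM2l ?invr_gt0.
- move=> h; suff -> : d = 2^-1 * (mdist x (pt X n) + mdist (pt X m) y) by left.
  by apply/eqP; rewrite eq_le h tpd_direct.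
- suff -> : d = 2^-1 * (mdist x (pt X k) + 1 + mdist (pt X k) y) by right.
  by apply/eqP; rewrite eq_le h tpd_via.
Qed.

Lemma tpd_sym p q : tpd p q = tpd q p.
Proof.
case: p q => [m x] [n y].
have [<-|mn] := eqVneq m n; first by rewrite !tpd_same metric_sym.
apply/eqP; rewrite eq_le; apply/andP; split.
- case: (@tpdP n m y x); rewrite 1?eq_sym//.
    by rewrite addrC (metric_sym y) (metric_sym _ x); exact: tpd_direct.
  move=> k kn km; apply: le_trans (tpd_via _ _ mn km kn) _.
  by rewrite (metric_sym y) (metric_sym _ x) ler_pM2l ?invr_gt0//; lra.
- case: (@tpdP m n x y) => //.
    rewrite addrC (metric_sym x) (metric_sym _ y).
    by apply: tpd_direct; rewrite eq_sym.
  move=> k km kn; apply: le_trans (tpd_via _ _ _ kn km) _; rewrite 1?eq_sym//.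
  by rewrite (metric_sym x) (metric_sym _ y) ler_pM2l ?invr_gt0//; lra.
Qed.

Lemma tpd_triangle q p r : tpd p r <= tpd p q + tpd q r.
Proof.
case: p q r => [m x] [n y] [s z].
have ge0 (u v : X) : 0 <= mdist u v := mdist_ge0 u v.
have le1 (u v : X) : mdist u v <= 1 := pm_le1 u v.
have tri (u v w : X) := @metric_triangle _ X u v w.
have p1 (j k : 'I_i) : j != k -> mdist (pt X j) (pt X k) = 1 := @pm_pt _ _ X j k.
have le_tpd : tpd (m, x) (s, z) <= 1.
  have [<-|ms] := eqVneq m s; first by rewrite tpd_same; have := le1 x z; lra.
  apply: le_trans (tpd_direct _ _ ms) _.
  by have := le1 x (pt X s); have := le1 (pt X m) z; lra.
have le_same : m = s -> tpd (m, x) (s, z) <= 2^-1.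
  by move=> <-; rewrite tpd_same; have := le1 x z; lra.
have [<-|mn] := eqVneq m n.
  rewrite tpd_same.
  have [<-|ms] := eqVneq m s; first by rewrite !tpd_same; have := tri x y z; lra.
  case: (@tpdP m s y z ms) => [|k km ks].
    apply: le_trans (tpd_direct _ _ ms) _.
    by have := tri x y (pt X s); lra.
  apply: le_trans (tpd_via _ _ ms km ks) _.
  by have := tri x y (pt X k); lra.
have [<-|ns] := eqVneq n s.
  rewrite tpd_same.
  case: (@tpdP m n x y mn) => [|k km kn].
    apply: le_trans (tpd_direct _ _ mn) _.
    by have := tri (pt X m) y z; lra.
  apply: le_trans (tpd_via _ _ mn km kn) _.
  by have := tri (pt X k) y z; lra.
have [ms|ms] := eqVneq m s.
  case: (@tpdP m n x y mn) => [|k km kn]; case: (@tpdP n s y z ns) => [|l ln ls];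
    do ?[by have := le_same ms; have := ge0 x (pt X k);
            have := ge0 (pt X k) y; have := ge0 y (pt X s);
            have := ge0 (pt X n) z; lra
        |by have := le_same ms; have := ge0 x (pt X n);
            have := ge0 (pt X m) y; have := ge0 y (pt X l);
            have := ge0 (pt X l) z; lra
        |by have := le_same ms; have := ge0 x (pt X k);
            have := ge0 (pt X k) y; have := ge0 y (pt X l);
            have := ge0 (pt X l) z; lra].
  rewrite -ms tpd_same.
  have := ge0 (pt X m) y; have := ge0 y (pt X m).
  by have := tri x (pt X n) z; lra.
case: (@tpdP m n x y mn) => [|k km kn]; case: (@tpdP n s y z ns) => [|l ln ls].
- apply: le_trans (tpd_via _ _ ms _ ns) _; first by rewrite eq_sym.
  have := tri (pt X m) y (pt X s); rewrite p1//.
  by lra.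
- have h := tri (pt X m) y (pt X l).
  have [lm|lm] := eqVneq l m.
    apply: le_trans (tpd_direct _ _ ms) _; rewrite lm.
    have := le1 x (pt X s); have := ge0 x (pt X n).
    by have := ge0 (pt X m) y; have := ge0 y (pt X m); lra.
  move: h; rewrite p1 1?eq_sym// => h.
  have := ge0 x (pt X n); have := ge0 (pt X l) z; lra.
- have h := tri (pt X k) y (pt X s).
  have [ks|ks] := eqVneq k s.
    apply: le_trans (tpd_direct _ _ ms) _; rewrite ks.
    have := le1 (pt X m) z; have := ge0 (pt X n) z.
    by have := ge0 (pt X s) y; have := ge0 y (pt X s); lra.
  move: h; rewrite p1// => h.
  have := ge0 x (pt X k); have := ge0 (pt X n) z; lra.
- have := ge0 x (pt X k); have := ge0 (pt X k) y.
  by have := ge0 y (pt X l); have := ge0 (pt X l) z; lra.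
Qed.

Lemma tpd_xx p : tpd p p = 0.
Proof. by case: p => m x; rewrite tpd_same mdistxx mulr0. Qed.

Lemma tpd_eq0 p q : glue_equiv p q <-> tpd p q = 0.
Proof.
have ge0 (u v : X) : 0 <= mdist u v := mdist_ge0 u v.
split => [/asboolP|].
  elim=> [_ _ [m n mn]|p' |p' q' _|p' q' r' _ pq _ qr].
  - case: (@tpdP m n (pt X n) (pt X m) mn) (tpd_direct (pt X n) (pt X m) mn).
      by rewrite !mdistxx addr0 mulr0.
    move=> k km kn; rewrite !mdistxx.
    by have := ge0 (pt X n) (pt X k); have := ge0 (pt X k) (pt X m); lra.
  - exact: tpd_xx.
  - by rewrite tpd_sym.
  - apply/eqP; rewrite eq_le (le_trans (tpd_triangle q' p' r')) ?pq ?qr ?addr0//.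
    by have := tpd_triangle r' p' p'; rewrite tpd_xx (tpd_sym r'); lra.
case: p q => [m x] [n y]; have [<-|mn] := eqVneq m n.
  rewrite tpd_same => h; apply/asboolP.
  rewrite (_ : x = y); first exact: rst_refl.
  by apply: mdist_positivity; lra.
case: (@tpdP m n x y mn) => [h|k km kn].
  have /mdist_positivity -> : mdist x (pt X n) = 0.
    by have := ge0 x (pt X n); have := ge0 (pt X m) y; lra.
  have /mdist_positivity <- : mdist (pt X m) y = 0.
    by have := ge0 x (pt X n); have := ge0 (pt X m) y; lra.
  by apply/asboolP; apply: rst_step.
by have := ge0 x (pt X k); have := ge0 (pt X k) y; lra.
Qed.

Lemma tensor_is_quotient_metric :
  is_quotient_metric glue_equiv_rel tensor_pre_dist.
Proof. by split; [exact: tpd_sym|exact: tpd_triangle|exact: tpd_eq0]. Qed.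

Definition tensor_type : Type := quotient_by tensor_is_quotient_metric.
HB.instance Definition _ := Metric.on tensor_type.
HB.instance Definition _ := Quotient.on tensor_type.

Definition tens (m : 'I_i) (x : X) : tensor_type :=
  \pi_(tensor_type) (m, x).

Lemma tens_surj (u : tensor_type) : exists m x, u = tens m x.
Proof.
by exists (repr u).1, (repr u).2; rewrite /tens -surjective_pairing reprK.
Qed.

Lemma tens_eqP m x n y : tens m x = tens n y <-> glue_equiv (m, x) (n, y).
Proof. by split => [/eqmodP|h]//; apply/eqmodP. Qed.

Lemma mdist_tens m x n y : mdist (tens m x) (tens n y) = tpd (m, x) (n, y).
Proof. exact: mdist_pi. Qed.

Lemma tensor_le1 (u v : tensor_type) : mdist u v <= 1.
Proof.
have [m [x ->]] := tens_surj u; have [n [y ->]] := tens_surj v.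
rewrite mdist_tens; have [<-|mn] := eqVneq m n.
  by rewrite tpd_same; have := pm_le1 x y; lra.
apply: le_trans (tpd_direct _ _ mn) _.
by have := pm_le1 x (pt X n); have := pm_le1 (pt X m) y; lra.
Qed.

Lemma tensor_pt m n : m != n ->
  mdist (tens m (pt X m)) (tens n (pt X n)) = 1.
Proof.
move=> mn; apply/eqP; rewrite eq_le tensor_le1/= mdist_tens.
case: (tpdP (pt X m) (pt X n) mn) => [|k km kn].
  by rewrite pm_pt//; lra.
by rewrite pm_pt 1?eq_sym// pm_pt//; lra.
Qed.

Definition tensor : pointedMetric R i :=
  PointedMetric tensor_le1 tensor_pt.

End TensorSpace.

Definition preserves_pt (X Y : pointedMetric R i) (f : X -> Y) :=
  forall j, f (pt X j) = pt Y j.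

(* Independent of the representative as soon as f preserves the points, see
   tensor_mapE. *)
Definition tensor_map (X Y : pointedMetric R i) (f : X -> Y)
    (u : tensor X) : tensor Y :=
  let: (m, x) := repr (u : tensor_type X) in tens m (f x).

Lemma tens_glue (X : pointedMetric R i) m n : m != n ->
  tens m (pt X n) = tens n (pt X m).
Proof. by move=> mn; apply/tens_eqP/asboolP; apply: rst_step. Qed.

Lemma tensor_mapE (X Y : pointedMetric R i) (f : X -> Y) m x :
  preserves_pt f -> tensor_map f (tens m x) = tens m (f x).
Proof.
move=> fpt; rewrite /tensor_map.
have : glue_equiv (repr (tens m x : tensor_type X)) (m, x).
  exact: repr_equiv.
case: (repr _) => n y /asboolP h.
suff : (fun p => tens p.1 (f p.2)) (n, y) =
       (fun p => tens p.1 (f p.2)) (m, x) by [].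
elim: h => [_ _ [j k jk]/=|//|//|p q r _ -> _ ->//].
by rewrite !fpt tens_glue.
Qed.

Lemma preserves_pt_tensor_map (X Y : pointedMetric R i) (f : X -> Y) :
  preserves_pt f -> preserves_pt (tensor_map f).
Proof. by move=> fpt j; rewrite tensor_mapE// fpt. Qed.

Definition isometric (X Y : pointedMetric R i) (f : X -> Y) :=
  forall x y, mdist (f x) (f y) = mdist x y.

Lemma isometric_tensor_map (X Y : pointedMetric R i) (f : X -> Y) :
  preserves_pt f -> isometric f -> isometric (tensor_map f).
Proof.
move=> fpt fiso u v.
have [m [x ->]] := tens_surj u; have [n [y ->]] := tens_surj v.
rewrite !tensor_mapE// !mdist_tens /= !fiso -!fpt !fiso.
by congr (_ * _); case: ifP => // _; apply: eq_bigr => k _; rewrite -!fpt !fiso.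
Qed.

(* The metric of the tensor is the quotient metric: the largest pseudometric
   below the metric of M_i * X, where distinct cells are at distance 1. *)
Lemma mdist_tens_max (X : pointedMetric R i)
    (rho : tensor X -> tensor X -> R) :
  (forall u, rho u u = 0) ->
  (forall u v, rho u v = rho v u) ->
  (forall v u w, rho u w <= rho u v + rho v w) ->
  (forall m n x y, rho (tens m x) (tens n y) <=
     if m == n then 2^-1 * mdist x y else 1) ->
  forall u v, rho u v <= mdist u v.
Proof.
move=> rho0 rhoS rhoT rhole u v.
have cell m x y : rho (tens m x) (tens m y) <= 2^-1 * mdist x y.
  by have := rhole m m x y; rewrite eqxx.
have [m [x ->]] := tens_surj u; have [n [y ->]] := tens_surj v.
rewrite mdist_tens; have [<-|mn] := eqVneq m n; first by rewrite tpd_same.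
case: (tpdP x y mn) => [|k km kn].
  have := rhoT (tens m (pt X n)) (tens m x) (tens n y).
  have := cell m x (pt X n); have := cell n (pt X m) y.
  by rewrite (tens_glue _ mn); lra.
have := rhoT (tens m (pt X k)) (tens m x) (tens n y).
have := rhoT (tens n (pt X k)) (tens m (pt X k)) (tens n y).
have := cell m x (pt X k); have := cell n (pt X k) y.
have := cell k (pt X m) (pt X n); rewrite pm_pt//.
rewrite (tens_glue _ km) (tens_glue _ kn).
by lra.
Qed.

Definition init_dist (j k : 'I_i) : R := (j != k)%:R.

Lemma init_dist_xx j : init_dist j j = 0.
Proof. by rewrite /init_dist eqxx. Qed.

Lemma init_dist_eq0 j k : init_dist j k = 0 -> j = k.
Proof.
by rewrite /init_dist; case: eqVneq => //= _ /eqP; rewrite oner_eq0.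
Qed.

Lemma init_dist_sym j k : init_dist j k = init_dist k j.
Proof. by rewrite /init_dist eq_sym. Qed.

Lemma init_dist_triangle k j l :
  init_dist j l <= init_dist j k + init_dist k l.
Proof.
rewrite /init_dist -natrD ler_nat.
by have [<-|] := eqVneq j k; have [|] := eqVneq k l; have [] := eqVneq j l.
Qed.

Definition init_type : Type := 'I_i.
HB.instance Definition _ := Choice.on init_type.
HB.instance Definition _ := @isMetric.Build R init_type init_dist
  init_dist_xx init_dist_eq0 init_dist_sym init_dist_triangle.

Lemma init_le1 (x y : init_type) : mdist x y <= 1 :> R.
Proof. by rewrite /mdist/= /init_dist; case: eqP. Qed.

Lemma init_pt (j k : 'I_i) :
  j != k -> mdist (j : init_type) (k : init_type) = 1 :> R.
Proof. by rewrite /mdist/= /init_dist => ->. Qed.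

Definition initial : pointedMetric R i :=
  @PointedMetric R i init_type id init_le1 init_pt.

Definition initial_map (X : pointedMetric R i) : initial -> X := pt X.

End Tensor.

Arguments tensor_map {R i X Y} f u.

Lemma mdist_tens2 (R : realType) (X : pointedMetric R 2) (x y : X) :
  mdist (tens 0 x) (tens 1 y) = 2^-1 * (mdist x (pt X 1) + mdist (pt X 0) y).
Proof.
rewrite mdist_tens /= big_pred0// => k; apply/negbTE.
by case: k => -[|[|]].
Qed.

Lemma mdist_tens3 (R : realType) (X : pointedMetric R 3) (x y : X) :
  let a := 0 : 'I_3 in let b := 1 : 'I_3 in let c := 2 : 'I_3 in
  let pT := pt X 0 in let pL := pt X 1 in let pR := pt X 2 in
  [/\ mdist (tens a x) (tens b y) = 2^-1 *
        Num.min (mdist x pL + mdist pT y) (mdist x pR + 1 + mdist pR y),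
      mdist (tens a x) (tens c y) = 2^-1 *
        Num.min (mdist x pR + mdist pT y) (mdist x pL + 1 + mdist pL y) &
      mdist (tens b x) (tens c y) = 2^-1 *
        Num.min (mdist x pR + mdist pL y) (mdist x pT + 1 + mdist pT y)].
Proof.
split; rewrite mdist_tens /=; congr (_ * _).
- rewrite ((@big_pred1_id _ _ _ _ (2 : 'I_3))) 1?minC// => k.
  by case: k => -[|[|[|]]].
- rewrite ((@big_pred1_id _ _ _ _ (1 : 'I_3))) 1?minC// => k.
  by case: k => -[|[|[|]]].
- rewrite ((@big_pred1_id _ _ _ _ (0 : 'I_3))) 1?minC// => k.
  by case: k => -[|[|[|]]].
Qed.

Section Colimit.
Context {R : realType} {i : nat}.
Variables (X : nat -> pointedMetric R i) (f : forall n, X n -> X n.+1).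
Arguments f {n}.
Hypothesis f_pt : forall n, preserves_pt (@f n).
Hypothesis f_iso : forall n, isometric (@f n).

Fixpoint push k n (x : X n) : X (k + n) :=
  if k is k'.+1 then f (push k' x) else x.

Definition embed n m (le_nm : (n <= m)%N) (x : X n) : X m :=
  ecast p (X p) (subnK le_nm) (push (m - n) x).

Lemma embed_refl n (h : (n <= n)%N) x : embed h x = x.
Proof.
rewrite /embed; move: (subnK h); rewrite subnn => e.
by rewrite (eq_irrelevance e erefl).
Qed.

Lemma embedS n m (h : (n <= m.+1)%N) (h' : (n <= m)%N) x :
  embed h x = f (embed h' x).
Proof.
rewrite /embed; move: (subnK h) (subnK h'); rewrite subSn//.
move: (m - n)%N => k e e'; rewrite /= in e *; case: _ / e' e => e.
by rewrite (eq_irrelevance e erefl).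
Qed.

Lemma embed_trans n m p (nm : (n <= m)%N) (mp : (m <= p)%N) (np : (n <= p)%N)
  x : embed mp (embed nm x) = embed np x.
Proof.
elim: p mp np => [|p IH] mp np.
  have m0 : m = 0 by apply/eqP; rewrite -leqn0.
  by subst m; rewrite embed_refl (eq_irrelevance nm np).
have [mp'|pm] := leqP m p.
  have np' := leq_trans nm mp'.
  by rewrite (embedS _ mp') (embedS _ np') (IH _ np').
have mE : m = p.+1 by apply/eqP; rewrite eqn_leq mp.
by subst m; rewrite embed_refl (eq_irrelevance nm np).
Qed.

Lemma embed_iso n m (h : (n <= m)%N) x y :
  mdist (embed h x) (embed h y) = mdist x y.
Proof.
rewrite /embed; move: (subnK h); move: (m - n)%N => k e; case: _ / e => /=.
by elim: k => //= k <-; rewrite f_iso.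
Qed.

Lemma embed_pt n m (h : (n <= m)%N) j : embed h (pt (X n) j) = pt (X m) j.
Proof.
rewrite /embed; move: (subnK h); move: (m - n)%N => k e; case: _ / e => /=.
by elim: k => //= k ->; rewrite f_pt.
Qed.

(* Both points are compared in the first stage that contains both of them. *)
Definition colim_pre_dist (p q : {n & X n}) : R :=
  mdist (embed (leq_maxl (tag p) (tag q)) (tagged p))
        (embed (leq_maxr (tag p) (tag q)) (tagged q)).

Lemma colim_pre_distE N (p q : {n & X n}) (h : (tag p <= N)%N)
    (h' : (tag q <= N)%N) :
  colim_pre_dist p q = mdist (embed h (tagged p)) (embed h' (tagged q)).
Proof.
have mN : (maxn (tag p) (tag q) <= N)%N by rewrite geq_max h.
by rewrite /colim_pre_dist -(embed_iso mN) !(embed_trans _ _ h, embed_trans _ _ h').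
Qed.

Definition colim_equiv (p q : {n & X n}) : bool :=
  embed (leq_maxl (tag p) (tag q)) (tagged p) ==
  embed (leq_maxr (tag p) (tag q)) (tagged q).

Lemma colim_equivE p q : colim_equiv p q <-> colim_pre_dist p q = 0.
Proof.
split=> [/eqP|/mdist_positivity/eqP//].
by rewrite /colim_pre_dist => ->; rewrite mdistxx.
Qed.

Lemma colim_dist_sym p q : colim_pre_dist p q = colim_pre_dist q p.
Proof.
rewrite (colim_pre_distE (leq_maxr (tag q) (tag p)) (leq_maxl (tag q) (tag p))).
by rewrite metric_sym.
Qed.

Lemma colim_dist_triangle q p r :
  colim_pre_dist p r <= colim_pre_dist p q + colim_pre_dist q r.
Proof.
pose N := maxn (tag p) (maxn (tag q) (tag r)).
have hp : (tag p <= N)%N by rewrite leq_maxl.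
have hq : (tag q <= N)%N by rewrite !leq_max leqnn !orbT.
have hr : (tag r <= N)%N by rewrite !leq_max leqnn !orbT.
rewrite (colim_pre_distE hp hr) (colim_pre_distE hp hq).
by rewrite (colim_pre_distE hq hr) metric_triangle.
Qed.

Lemma colim_equiv_refl : reflexive colim_equiv.
Proof.
move=> p; apply/colim_equivE.
by rewrite (colim_pre_distE (leqnn _) (leqnn _)) mdistxx.
Qed.

Lemma colim_equiv_sym : symmetric colim_equiv.
Proof.
by move=> p q; apply/idP/idP => /colim_equivE h; apply/colim_equivE;
  rewrite colim_dist_sym.
Qed.

Lemma colim_equiv_trans : transitive colim_equiv.
Proof.
move=> q p r /colim_equivE pq /colim_equivE qr; apply/colim_equivE.
apply/eqP; rewrite eq_le mdist_ge0 andbT.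
by rewrite (le_trans (colim_dist_triangle q p r))// pq qr addr0.
Qed.

Canonical colim_equiv_rel :=
  EquivRel colim_equiv colim_equiv_refl colim_equiv_sym colim_equiv_trans.

Lemma colim_is_quotient_metric :
  is_quotient_metric colim_equiv_rel colim_pre_dist.
Proof.
by split; [exact: colim_dist_sym|exact: colim_dist_triangle|
           exact: colim_equivE].
Qed.

Definition colim_type : Type := quotient_by colim_is_quotient_metric.
HB.instance Definition _ := Metric.on colim_type.
HB.instance Definition _ := Quotient.on colim_type.

Definition colim_in n (x : X n) : colim_type :=
  \pi_(colim_type) (Tagged (fun n => X n) x).

Lemma colim_in_surj (u : colim_type) : exists n (x : X n), u = colim_in x.
Proof.
exists (tag (repr u)), (tagged (repr u)); rewrite /colim_in.
by rewrite (_ : Tagged _ _ = repr u) ?reprK//; case: (repr u).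
Qed.

Lemma mdist_colim_in n (x y : X n) :
  mdist (colim_in x) (colim_in y) = mdist x y.
Proof.
rewrite [LHS]mdist_pi.
rewrite (@colim_pre_distE n (Tagged (fun n => X n) x)
  (Tagged (fun n => X n) y) (leqnn n) (leqnn n)).
by rewrite !embed_refl.
Qed.

Lemma colim_in_f n (x : X n) : colim_in (f x) = colim_in x.
Proof.
apply/eqmodP/colim_equivE.
rewrite (@colim_pre_distE n.+1 (Tagged (fun n => X n) (f x))
  (Tagged (fun n => X n) x) (leqnn _) (leqnSn _)) /=.
by rewrite (embedS _ (leqnn n)) !embed_refl mdistxx.
Qed.

Lemma colim_in_embed n m (h : (n <= m)%N) (x : X n) :
  colim_in (embed h x) = colim_in x.
Proof.
elim: m h => [|m IH] h.
  have n0 : n = 0 by apply/eqP; rewrite -leqn0.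
  by subst n; rewrite embed_refl.
have [h'|h'] := leqP n m; first by rewrite (embedS _ h') colim_in_f IH.
have nE : n = m.+1 by apply/eqP; rewrite eqn_leq h.
by subst n; rewrite embed_refl.
Qed.

Lemma colim_in2 (u v : colim_type) :
  exists n (x y : X n), u = colim_in x /\ v = colim_in y.
Proof.
have [n [x ->]] := colim_in_surj u; have [m [y ->]] := colim_in_surj v.
exists (maxn n m), (embed (leq_maxl n m) x), (embed (leq_maxr n m) y).
by rewrite !colim_in_embed.
Qed.

Lemma colim_le1 (u v : colim_type) : mdist u v <= 1.
Proof.
by have [n [x [y [-> ->]]]] := colim_in2 u v; rewrite mdist_colim_in pm_le1.
Qed.

Lemma colim_pt j k : j != k ->
  mdist (colim_in (pt (X 0) j)) (colim_in (pt (X 0) k)) = 1.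
Proof. by move=> jk; rewrite mdist_colim_in pm_pt. Qed.

Definition colim : pointedMetric R i := PointedMetric colim_le1 colim_pt.

Lemma preserves_pt_colim_in n : preserves_pt (@colim_in n : X n -> colim).
Proof.
by move=> j /=; rewrite -(colim_in_embed (leq0n n)) embed_pt.
Qed.

End Colimit.

Section FreeChain.
Variables (R : realType) (i : nat).

Fixpoint chain (n : nat) : pointedMetric R i :=
  if n is n'.+1 then tensor (chain n') else initial.

Fixpoint chain_map (n : nat) : chain n -> chain n.+1 :=
  if n is n'.+1 return chain n -> chain n.+1 then tensor_map (@chain_map n')
  else initial_map (tensor initial).

Lemma chain_map_pt n : preserves_pt (@chain_map n).
Proof. by elim: n => //= n IH; exact: preserves_pt_tensor_map. Qed.

Lemma chain_map_iso n : isometric (@chain_map n).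
Proof.
elim: n => [j k|n IH] /=; last exact: isometric_tensor_map (@chain_map_pt n) IH.
have [<-|jk] := eqVneq j k; first by rewrite !mdistxx.
transitivity (1 : R); first exact: (@pm_pt _ _ (tensor initial) j k jk).
by symmetry; exact: (@pm_pt _ _ initial j k jk).
Qed.

Definition Gspace : pointedMetric R i := colim chain_map_iso.

Definition G_in n (x : chain n) : Gspace :=
  colim_in chain_map_iso x.

Lemma G_in_pt n : preserves_pt (@G_in n).
Proof. exact: (@preserves_pt_colim_in _ _ chain chain_map chain_map_pt chain_map_iso n). Qed.

Lemma G_in_iso n : isometric (@G_in n).
Proof. by move=> x y; apply: mdist_colim_in. Qed.

(* g_pre m [x] = [m (x) x], see g_preE. *)
Definition g_pre (m : 'I_i) (v : Gspace) : Gspace :=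
  let: existT n x := repr (v : colim_type chain_map_iso) in
  G_in (tens m x : chain n.+1).

Lemma g_preE m n (x : chain n) :
  g_pre m (G_in x) = G_in (tens m x : chain n.+1).
Proof.
have step p (y : chain p) q (h : (p <= q)%N) :
    G_in (tens m (embed chain_map h y) : chain q.+1) =
    G_in (tens m y : chain p.+1).
  elim: q h => [|q IH] h.
    have p0 : p = 0 by apply/eqP; rewrite -leqn0.
    by subst p; rewrite embed_refl.
  have [h'|h'] := leqP p q; last first.
    have pE : p = q.+1 by apply/eqP; rewrite eqn_leq h.
    by subst p; rewrite embed_refl.
  rewrite (embedS _ _ h') -(IH h') -(tensor_mapE _ _ (@chain_map_pt q)).
  exact: (@colim_in_f _ _ _ _ chain_map_iso q.+1).
have : colim_equiv chain_map (repr (G_in x : colim_type chain_map_iso))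
    (Tagged chain x).
  exact: (repr_equiv (colim_is_quotient_metric chain_map_iso)).
rewrite /g_pre; case: (repr _) => p y /eqP /= h.
rewrite -(step _ y _ (leq_maxl p n)) -(step _ x _ (leq_maxr p n)).
by congr (G_in (tens m _ : chain _.+1)).
Qed.

Definition g_map (u : tensor Gspace) : Gspace :=
  let: (m, v) := repr (u : tensor_type Gspace) in g_pre m v.

Lemma g_mapE m n (x : chain n) :
  g_map (tens m (G_in x)) = G_in (tens m x : chain n.+1).
Proof.
rewrite -g_preE.
have : glue_equiv (repr (tens m (G_in x) : tensor_type Gspace)) (m, G_in x).
  exact: repr_equiv.
rewrite /g_map; case: (repr _) => p y /asboolP h.
suff : (fun p => g_pre p.1 p.2) (p, y) =
       (fun p => g_pre p.1 p.2) (m, G_in x) by [].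
elim: h => [_ _ [j k jk]|//|//|a b c _ -> _ ->//].
change (g_pre j (pt Gspace k) = g_pre k (pt Gspace j)).
by rewrite -!(G_in_pt 0) !g_preE tens_glue.
Qed.

Lemma g_map_pt : preserves_pt g_map.
Proof.
move=> j; change (g_map (tens j (pt Gspace j)) = pt Gspace j).
by rewrite -{1}(G_in_pt 0) g_mapE -(G_in_pt 1).
Qed.

Lemma tens_G_in2 (u v : tensor Gspace) : exists n (x y : chain n.+1),
  u = tensor_map (@G_in n) x /\ v = tensor_map (@G_in n) y.
Proof.
have [m [x ->]] := tens_surj u; have [p [y ->]] := tens_surj v.
have [n [x' [y' [-> ->]]]] := colim_in2 x y.
exists n, (tens m x'), (tens p y').
by rewrite !tensor_mapE//; exact: G_in_pt.
Qed.

Lemma g_map_G_in n (x : chain n.+1) : g_map (tensor_map (@G_in n) x) = G_in x.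
Proof.
have [m [y ->]] := tens_surj x.
by rewrite tensor_mapE ?g_mapE//; exact: G_in_pt.
Qed.

Lemma g_map_iso : isometric g_map.
Proof.
move=> u v; have [n [x [y [-> ->]]]] := tens_G_in2 u v.
rewrite !g_map_G_in G_in_iso isometric_tensor_map//.
  exact: G_in_pt.
exact: G_in_iso.
Qed.

Lemma g_map_surj (v : Gspace) : exists u, g_map u = v.
Proof.
have [n [x ->]] := colim_in_surj v.
exists (tensor_map (@G_in n) (chain_map x)); rewrite g_map_G_in.
exact: (@colim_in_f _ _ _ _ chain_map_iso n).
Qed.

End FreeChain.

Section Sequences.
Context {R : realType} {T : metricType R}.

Lemma cauchy_seqP (u : nat -> T) : cauchy (u @ \oo) <->
  forall e : R, 0 < e -> exists N, forall m n, (N <= m)%N -> (N <= n)%N ->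
    mdist (u m) (u n) < e.
Proof.
split=> [/cauchy_ballP cu e e0|h].
  have [[A B] /= [[N1 _ h1] [N2 _ h2]] AB] := cu e e0.
  exists (maxn N1 N2) => m n; rewrite !geq_max => /andP[m1 m2] /andP[n1 n2].
  have /= := AB (u m, u n); rewrite ballEmdist; apply; split => /=.
  - exact: h1.
  - exact: h2.
apply/cauchy_ballP => e e0; have [N hN] := h e e0.
exists ([set u n | n in [set n | (N <= n)%N]],
        [set u n | n in [set n | (N <= n)%N]]).
  by split; exists N => // n /= Nn; exists n.
by move=> [_ _] /= [[m Nm <-] [n Nn <-]]; rewrite ballEmdist /=; exact: hN.
Qed.

Lemma cvg_seqP (u : nat -> T) (l : T) : u n @[n --> \oo] --> l <->
  forall e : R, 0 < e -> exists N, forall n, (N <= n)%N -> mdist l (u n) < e.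
Proof.
rewrite metricType_numDomainType.cvgrPdist_lt; split => h e /h.
  by move=> [N _ hN]; exists N => n Nn; exact: hN.
by move=> [N hN]; exists N.
Qed.

Lemma cvg_cauchy_seq (u : nat -> T) (l : T) :
  u n @[n --> \oo] --> l -> cauchy (u @ \oo).
Proof.
move=> /cvg_seqP ul; apply/cauchy_seqP => e e0.
have [|N hN] := ul (e / 2); first by rewrite divr_gt0.
exists N => m n /hN lm /hN ln.
have := metric_triangle (u m) l (u n); by rewrite (metric_sym (u m) l); lra.
Qed.

Lemma cvg_mdist (u v : nat -> T) (l k : T) :
  u n @[n --> \oo] --> l -> v n @[n --> \oo] --> k ->
  mdist (u n) (v n) @[n --> \oo] --> mdist l k.
Proof.
move=> /cvg_seqP ul /cvg_seqP vk; apply/cvgrPdist_lt => e e0.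
have [|N hN] := ul (e / 2); first by rewrite divr_gt0.
have [|M hM] := vk (e / 2); first by rewrite divr_gt0.
exists (maxn N M) => // n /=; rewrite geq_max => /andP[/hN a /hM b].
have := metric_triangle l (u n) k; have := metric_triangle (u n) (v n) k.
have := metric_triangle (u n) l (v n); have := metric_triangle l k (v n).
rewrite (metric_sym (v n) k) (metric_sym (u n) l) => *.
by rewrite /= ltr_norml; apply/andP; split; lra.
Qed.

Lemma cvg_mdist_cauchy (u v : nat -> T) : cauchy (u @ \oo) ->
  cauchy (v @ \oo) -> cvg (mdist (u n) (v n) @[n --> \oo]).
Proof.
move=> /cauchy_seqP cu /cauchy_seqP cv.
apply/cauchy_cvgP/(@cauchy_ballP R R) => e e0.
have [|N hN] := cu (e / 2); first by rewrite divr_gt0.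
have [|M hM] := cv (e / 2); first by rewrite divr_gt0.
pose A := [set mdist (u n) (v n) | n in [set n | (maxn N M <= n)%N]].
exists (A, A).
  by split; exists (maxn N M) => // n /= Nn; exists n.
move=> [_ _] [[m /= mNM <-] [n /= nNM <-]] /=.
move: mNM nNM; rewrite !geq_max => /andP[mN mM] /andP[nN nM].
have := hN _ _ mN nN; have := hM _ _ mM nM.
have := metric_triangle (u m) (u n) (v m).
have := metric_triangle (u n) (v n) (v m).
have := metric_triangle (u n) (u m) (v n).
have := metric_triangle (u m) (v m) (v n).
rewrite (metric_sym (u n) (u m)) (metric_sym (v n) (v m)) => *.
by rewrite /ball/= ltr_norml; apply/andP; split; lra.
Qed.

Definition seq_complete :=
  forall u : nat -> T, cauchy (u @ \oo) -> exists l : T, u n @[n --> \oo] --> l.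

End Sequences.
Arguments seq_complete {R} T.

Section Completion.
Context {R : realType} {i : nat} (X : pointedMetric R i).

Definition cauchy_seq : Type := {u : nat -> X | `[< cauchy (u @ \oo) >]}.
HB.instance Definition _ := Choice.on cauchy_seq.

Lemma cauchy_seq_cauchy (u : cauchy_seq) : cauchy (sval u @ \oo).
Proof. exact/asboolP/(svalP u). Qed.

Definition limit_dist (u v : cauchy_seq) : R :=
  limn (fun n => mdist (sval u n) (sval v n)).

Lemma cvg_limit_dist (u v : cauchy_seq) :
  mdist (sval u n) (sval v n) @[n --> \oo] --> limit_dist u v.
Proof. exact: cvg_mdist_cauchy (cauchy_seq_cauchy u) (cauchy_seq_cauchy v). Qed.

Arguments cvg_limit_dist : clear implicits.

Lemma limit_dist_sym u v : limit_dist u v = limit_dist v u.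
Proof.
by rewrite /limit_dist; congr (limn _); apply/funext => n; rewrite metric_sym.
Qed.

Lemma limit_dist_triangle v u w :
  limit_dist u w <= limit_dist u v + limit_dist v w.
Proof.
have uw := cvg_limit_dist u w.
have uvw := cvgD (cvg_limit_dist u v) (cvg_limit_dist v w).
apply: (ler_cvg_to uw (uvw _)).
by near=> n; exact: metric_triangle.
Unshelve. all: by end_near. Qed.

Lemma limit_dist_xx u : limit_dist u u = 0.
Proof.
rewrite /limit_dist (_ : (fun n => _) = fun=> 0) ?lim_cst//.
by apply/funext => n; rewrite mdistxx.
Qed.

Lemma limit_dist_ge0 u v : 0 <= limit_dist u v.
Proof.
have := limit_dist_triangle v u u.
by rewrite limit_dist_xx (limit_dist_sym v u); lra.
Qed.

Definition cauchy_equiv (u v : cauchy_seq) : bool :=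
  `[< mdist (sval u n) (sval v n) @[n --> \oo] --> (0 : R) >].

Lemma cauchy_equivE u v : cauchy_equiv u v <-> limit_dist u v = 0.
Proof.
split=> [/asboolP h|h].
  exact: cvg_lim h.
by apply/asboolP; rewrite -h; exact: cvg_limit_dist.
Qed.

Lemma cauchy_equiv_refl : reflexive cauchy_equiv.
Proof. by move=> u; apply/cauchy_equivE; exact: limit_dist_xx. Qed.

Lemma cauchy_equiv_sym : symmetric cauchy_equiv.
Proof.
by move=> u v; apply/idP/idP => /cauchy_equivE h; apply/cauchy_equivE;
  rewrite limit_dist_sym.
Qed.

Lemma cauchy_equiv_trans : transitive cauchy_equiv.
Proof.
move=> v u w /cauchy_equivE uv /cauchy_equivE vw; apply/cauchy_equivE.
apply/eqP; rewrite eq_le limit_dist_ge0 andbT.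
by rewrite (le_trans (limit_dist_triangle v u w))// uv vw addr0.
Qed.

Canonical cauchy_equiv_rel := EquivRel cauchy_equiv
  cauchy_equiv_refl cauchy_equiv_sym cauchy_equiv_trans.

Lemma completion_is_quotient_metric :
  is_quotient_metric cauchy_equiv_rel limit_dist.
Proof.
by split; [exact: limit_dist_sym|exact: limit_dist_triangle|
           exact: cauchy_equivE].
Qed.

Definition completion_type : Type := quotient_by completion_is_quotient_metric.
HB.instance Definition _ := Metric.on completion_type.
HB.instance Definition _ := Quotient.on completion_type.

Lemma cst_cauchy (x : X) : `[< cauchy ((fun=> x) @ \oo) >].
Proof.
by apply/asboolP/cauchy_seqP => e e0; exists 0 => *; rewrite mdistxx.
Qed.

Definition completion_in (x : X) : completion_type :=
  \pi_(completion_type) (exist _ (fun=> x) (cst_cauchy x) : cauchy_seq).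

Lemma mdist_completion_in x y :
  mdist (completion_in x) (completion_in y) = mdist x y.
Proof. by rewrite [LHS]mdist_pi /limit_dist /= lim_cst. Qed.

Lemma completion_le1 (s t : completion_type) : mdist s t <= 1.
Proof.
change (limit_dist (repr s) (repr t) <= 1).
apply: (ler_cvg_to (cvg_limit_dist (repr s) (repr t)) (cvg_cst (1 : R))).
by near=> n; exact: pm_le1.
Unshelve. all: by end_near. Qed.

Lemma completion_pt j k : j != k ->
  mdist (completion_in (pt X j)) (completion_in (pt X k)) = 1.
Proof. by move=> jk; rewrite mdist_completion_in pm_pt. Qed.

Definition completion : pointedMetric R i :=
  PointedMetric completion_le1 completion_pt.

Lemma cvg_completion (u : cauchy_seq) :
  completion_in (sval u n) @[n --> \oo] --> \pi_(completion_type) u.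
Proof.
have /cauchy_seqP cu := cauchy_seq_cauchy u.
apply/(@cvg_seqP _ completion) => e e0.
have [|N hN] := cu (e / 2); first by rewrite divr_gt0.
exists N => n Nn; apply: (@le_lt_trans _ _ (e / 2)); last by lra.
rewrite [leLHS]mdist_pi.
apply: (ler_cvg_to (cvg_limit_dist _ _) (cvg_cst (e / 2 : R))).
by exists N => // m Nm /=; exact/ltW/hN.
Qed.

Arguments cvg_completion : clear implicits.

Lemma completion_dense (s : completion) : exists2 u : nat -> X,
  cauchy (u @ \oo) & completion_in (u n) @[n --> \oo] --> s.
Proof.
exists (sval (repr (s : completion_type))); first exact: cauchy_seq_cauchy.
by have := cvg_completion (repr (s : completion_type)); rewrite reprK.
Qed.

Lemma completion_complete : seq_complete completion.
Proof.
move=> s cs; pose c (x : X) : completion := completion_in x.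
have c_iso x y : mdist (c x) (c y) = mdist x y by exact: mdist_completion_in.
have near_s n : exists x : X, mdist (c x) (s n) < n.+1%:R^-1.
  have [u _ /(@cvg_seqP _ completion) us] := completion_dense (s n).
  have [|N /(_ N (leqnn N))] := us n.+1%:R^-1; first by rewrite invr_gt0.
  by rewrite metric_sym; exists (u N).
have [x hx] := choice near_s.
have inv_lt (e : R) : 0 < e -> exists N, forall n, (N <= n)%N -> n.+1%:R^-1 < e.
  move=> e0; have /cvgrPdist_lt /(_ e e0)[N _ hN] := @cvg_harmonic R.
  exists N => n Nn; have := hN n Nn.
  by rewrite /= sub0r normrN ger0_norm ?invr_ge0.
have cx : `[< cauchy (x @ \oo) >].
  apply/asboolP/cauchy_seqP => e e0.
  have e3 : 0 < e / 3 by rewrite divr_gt0.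
  have [N hN] := inv_lt _ e3.
  have [M hM] := proj1 (@cauchy_seqP _ completion s) cs _ e3.
  exists (maxn N M) => m n; rewrite !geq_max => /andP[mN mM] /andP[nN nM].
  rewrite -c_iso.
  have := metric_triangle (c (x m)) (s m) (c (x n)).
  have := metric_triangle (s m) (s n) (c (x n)).
  rewrite (metric_sym (s n) (c (x n))).
  have := lt_trans (hx m) (hN _ mN); have := lt_trans (hx n) (hN _ nN).
  have : mdist (s m) (s n) < e / 3 := hM _ _ mM nM.
  by lra.
have /(@cvg_seqP _ completion) xl := cvg_completion (exist _ x cx).
exists (\pi_(completion_type) (exist _ x cx : cauchy_seq)).
apply/(@cvg_seqP _ completion) => e e0.
have e2 : 0 < e / 2 by rewrite divr_gt0.
have [N hN] := inv_lt _ e2; have [M hM] := xl _ e2.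
exists (maxn N M) => n; rewrite geq_max => /andP[nN nM].
apply: le_lt_trans (metric_triangle _ (c (x n)) _) _.
have : mdist (\pi_(completion_type) (exist _ x cx : cauchy_seq)) (c (x n))
  < e / 2 := hM _ nM.
by have := lt_trans (hx n) (hN _ nN); lra.
Qed.

End Completion.

Section Extension.
Context {R : realType} {i : nat}.

Lemma tensor_complete (X : pointedMetric R i) :
  seq_complete X -> seq_complete (tensor X).
Proof.
move=> Xc w /(@cauchy_seqP _ (tensor X)) cw.
have w_tens n : exists p : 'I_i * X, w n = tens p.1 p.2.
  by have [m [x ->]] := tens_surj (w n); exists (m, x).
have [p hp] := choice w_tens.
have [j hj] : exists j, forall N, exists n, (N <= n)%N /\ (p n).1 = j.
  apply: contrapT => /forallNP h.
  have {}h j : exists N, forall n, (N <= n)%N -> (p n).1 <> j.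
    have /existsNP[N hN] := h j; exists N => n Nn pn; apply: hN.
    by exists n.
  have [N hN] := choice h.
  by apply: (hN (p (\max_(j < i) N j)).1 (\max_(j < i) N j) _ erefl);
    exact: leq_bigmax.
have [k hk] := choice hj.
have wk n : w (k n) = tens j (p (k n)).2.
  by rewrite hp; have [_ ->] := hk n.
have [|l /(@cvg_seqP _ X) hl] := Xc (fun n => (p (k n)).2).
  apply/(@cauchy_seqP _ X) => e e0.
  have [|N hN] := cw (e / 2); first by rewrite divr_gt0.
  exists N => m n Nm Nn.
  have [km _] := hk m; have [kn _] := hk n.
  have := hN (k m) (k n) (leq_trans Nm km) (leq_trans Nn kn).
  by rewrite !wk mdist_tens tpd_same; lra.
exists (tens j l); apply/(@cvg_seqP _ (tensor X)) => e e0.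
have e2 : 0 < e / 2 by rewrite divr_gt0.
have [N hN] := cw _ e2; have [M hM] := hl _ e2.
exists (maxn N M) => n; rewrite geq_max => /andP[nN nM].
have [kn _] := hk n.
have := @metric_triangle _ (tensor X) (tens j l) (w (k n)) (w n).
have := hN (k n) n (leq_trans nN kn) nN.
have : mdist (tens j l : tensor X) (w (k n)) < e / 2.
  rewrite wk mdist_tens tpd_same.
  by have := hM n nM; have := mdist_ge0 l (p (k n)).2; lra.
by lra.
Qed.

Lemma mdist_limit_eq (T T' : metricType R) (u v : nat -> T) (u' v' : nat -> T')
    (l k : T) (l' k' : T') :
  (forall n, mdist (u n) (v n) = mdist (u' n) (v' n)) ->
  u n @[n --> \oo] --> l -> v n @[n --> \oo] --> k ->
  u' n @[n --> \oo] --> l' -> v' n @[n --> \oo] --> k' ->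
  mdist l k = mdist l' k'.
Proof.
move=> h ul vk /cvg_mdist ul' /ul' b; have a := cvg_mdist ul vk.
rewrite (_ : (fun n => _) = (fun n => mdist (u' n) (v' n))) in a.
  exact: (cvg_unique _ a b).
exact/funext.
Qed.

Lemma isometric_extension (X Y : pointedMetric R i) (f : X -> Y) :
  seq_complete Y -> isometric f -> exists F : completion X -> Y,
    isometric F /\ forall x, F (completion_in x) = f x.
Proof.
move=> Yc f_iso; pose c (x : X) : completion X := completion_in x.
have c_iso x y : mdist (c x) (c y) = mdist x y by exact: mdist_completion_in.
have h (s : completion X) : exists l : Y, exists u : nat -> X,
    (c (u n) @[n --> \oo] --> s) /\ (f (u n) @[n --> \oo] --> l).
  have [u cu us] := completion_dense s.
  have [|l hl] := Yc (f \o u).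
    apply/(@cauchy_seqP _ Y) => e e0.
    have [N hN] := proj1 (cauchy_seqP u) cu e e0.
    by exists N => m n /= Nm Nn; rewrite f_iso; exact: hN.
  by exists l, u.
have [F hF] := choice h.
exists F; split=> [s t|x].
  have [u [us fu]] := hF s; have [v [vt fv]] := hF t.
  apply: (mdist_limit_eq _ fu fv us vt) => n.
  by rewrite f_iso c_iso.
have [u [us fu]] := hF (c x).
apply/mdist_positivity; rewrite -(mdistxx (c x)).
apply: (mdist_limit_eq _ fu (cvg_cst (f x)) us (cvg_cst (c x))) => n.
by rewrite f_iso c_iso.
Qed.

Lemma isometric_continuous (X Y : pointedMetric R i) (f : X -> Y) :
  isometric f -> continuous f.
Proof.
move=> f_iso x; apply/metricType_numDomainType.cvgrPdist_lt => e e0.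
apply/metricType_numDomainType.nbhs_mdistP.
by exists e => // y; rewrite /= f_iso.
Qed.

End Extension.

Section FinalCoalgebra.
Variables (R : realType) (i : nat).

Definition Sspace : pointedMetric R i := completion (Gspace R i).

Definition G_to_S : Gspace R i -> Sspace := @completion_in R i (Gspace R i).

Lemma G_to_S_pt : preserves_pt G_to_S.
Proof. by []. Qed.

Lemma G_to_S_iso : isometric G_to_S.
Proof. exact: mdist_completion_in. Qed.

Definition extends_g_inv (psi : Sspace -> tensor Sspace) :=
  forall u : tensor (Gspace R i), psi (G_to_S (g_map u)) = tensor_map G_to_S u.

Lemma exists_psi : exists psi : Sspace -> tensor Sspace,
  continuous psi /\ extends_g_inv psi.
Proof.
have [h hK] := choice (@g_map_surj R i).
have h_iso : isometric (tensor_map G_to_S \o h).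
  move=> u v /=; rewrite (isometric_tensor_map G_to_S_pt G_to_S_iso).
  by rewrite -(@g_map_iso R i) !hK.
have [psi [psi_iso psiE]] := isometric_extension
  (tensor_complete (completion_complete (X := Gspace R i))) h_iso.
exists psi; split=> [|u]; first exact: isometric_continuous.
rewrite [LHS]psiE /=; congr tensor_map.
by apply/mdist_positivity; rewrite -(@g_map_iso R i) hK mdistxx.
Qed.

Lemma psi_unique (psi psi' : Sspace -> tensor Sspace) :
  continuous psi -> extends_g_inv psi ->
  continuous psi' -> extends_g_inv psi' -> psi = psi'.
Proof.
move=> ct pE ct' pE'; apply/funext => s.
have [u _ us] := completion_dense s.
have a := continuous_cvg _ (ct s) us.
have b := continuous_cvg _ (ct' s) us.
have E n : psi (completion_in (u n)) = psi' (completion_in (u n)).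
  have [v <-] := g_map_surj (u n).
  by rewrite [LHS]pE [RHS]pE'.
apply/mdist_positivity; rewrite -(mdistxx (psi s)).
apply: (mdist_limit_eq _ (a _) (b _) (a _) (a _)) => n /=.
by rewrite E.
Qed.

(* The continuous extension of the inverse of the bijection g_map along
   G -> S; it is unique by psi_unique. *)
Definition psi : Sspace -> tensor Sspace := sval (cid exists_psi).

Lemma psi_continuous : continuous psi.
Proof. exact: (svalP (cid exists_psi)).1. Qed.

Lemma psi_extends : extends_g_inv psi.
Proof. exact: (svalP (cid exists_psi)).2. Qed.

Lemma psi_G_in m n (x : chain R i n) :
  psi (G_to_S (G_in (tens m x : chain R i n.+1))) = tens m (G_to_S (G_in x)).
Proof. by rewrite -g_mapE psi_extends tensor_mapE. Qed.

End FinalCoalgebra.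

Section Coalgebras.
Context {R : realType} {i : nat}.

Definition short_hom (X Y : pointedMetric R i) (f : X -> Y) : Prop :=
  preserves_pt f /\ forall x y, mdist (f x) (f y) <= mdist x y.

Definition continuous_hom (X Y : pointedMetric R i) (f : X -> Y) : Prop :=
  preserves_pt f /\ continuous f.

(* hom is the class of morphisms of the category; its objects are the i-pointed
   metric spaces. *)
Variable hom : forall X Y : pointedMetric R i, (X -> Y) -> Prop.

Definition is_coalgebra (X : pointedMetric R i) (e : X -> tensor X) : Prop :=
  hom e.

Definition is_coalgebra_hom (X Y : pointedMetric R i) (e : X -> tensor X)
    (e' : Y -> tensor Y) (f : X -> Y) : Prop :=
  hom f /\ e' \o f = tensor_map f \o e.

Definition is_final_coalgebra (Y : pointedMetric R i) (e' : Y -> tensor Y)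
    : Prop :=
  is_coalgebra e' /\
  forall (X : pointedMetric R i) (e : X -> tensor X), is_coalgebra e ->
    exists! f : X -> Y, is_coalgebra_hom e e' f.

End Coalgebras.

(* Main.v *)
Require Import Defs.
From mathcomp Require Import all_boot all_order all_algebra.
From mathcomp Require Import lra.
From mathcomp Require Import all_classical all_reals.
From mathcomp Require Import topology normedtype sequences.

(** Why the theorem holds.  The structure map psi is a bijective isometry onto
    the tensor of a complete space, so a point-preserving f solves
    psi \o f = tensor_map f \o e exactly when it is a fixed point of the
    operator f |-> psi^-1 \o tensor_map f \o e.  Two points of one cell are
    half as far apart in the tensor as in the space, so this operator halves
    uniform distances; as all distances are at most 1, iterating it on
    arbitrary point-preserving functions, continuous or not, converges
    uniformly to the one solution ([exists_solution], [solution_unique]).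
    This settles existence and uniqueness at the level of pointed sets,
    whatever the category of metric spaces.

    It remains to see that the solution f is a morphism when e is.  Both cases
    improve a trivial bound by a factor 2 at each unfolding of e.

    If e is short, the excess of mdist (f x) (f y) over mdist x y is at most 1.
    Unfolding once halves it when e x and e y lie in one cell, but a path
    between two different cells has two pieces, which together could give the
    excess back.  When y is a distinguished point only one of the pieces has
    an excess, so distances to distinguished points do not increase
    ([solution_pt_le]); the pieces of paths between different cells end at such
    points, hence carry no excess at all ([solution_short]).

    If e is continuous, every x has a neighbourhood on which f stays within 1
    of f x.  Points of the tensor close to e x lie in a cell that contains e x,
    and are there close to e x as points of this cell ([near_tens]).  So f near
    x is a half-scale copy of f near one of the finitely many points
    representing e x, and 1 may be replaced by 1/2, 1/4, and so on
    ([solution_continuous]). *)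

Set Implicit Arguments.
Unset Strict Implicit.
Unset Printing Implicit Defensive.

Import Order.TTheory GRing.Theory Num.Theory.
Import numFieldNormedType.Exports.
Local Open Scope classical_set_scope.
Local Open Scope ring_scope.

(** * Powers of one half *)

Section Halving.
Context {R : realType}.

Lemma half_pow_lt (e : R) : 0 < e -> exists n, 2^-1 ^+ n < e.
Proof.
move=> e0.
have /cvgrPdist_lt /(_ e e0) [N _ /(_ N (leqnn N))] :
    (2^-1 : R) ^+ n @[n --> \oo] --> (0 : R).
  by apply: cvg_expr; rewrite ger0_norm ?invr_ge0//; lra.
by rewrite /= sub0r normrN ger0_norm ?exprn_ge0 ?invr_ge0// => h; exists N.
Qed.

Lemma half_pow_ge0 n : 0 <= (2^-1 : R) ^+ n.
Proof. by rewrite exprn_ge0 ?invr_ge0. Qed.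

Lemma le_half_pow (a b : R) : (forall n, a <= b + 2^-1 ^+ n) -> a <= b.
Proof.
move=> h; apply/ler_addgt0Pr => e /half_pow_lt [n ne].
by have := h n; lra.
Qed.

End Halving.

(** * Maps between tensors *)

Section TensorEstimates.
Context {R : realType} {i : nat}.
Implicit Types X Y : pointedMetric R i.

(** Both values lie in the cell of the argument, where distances are halved. *)
Lemma mdist_tensor_map_le X Y (f g : X -> Y) (c : R) :
  preserves_pt f -> preserves_pt g -> (forall x, mdist (f x) (g x) <= c) ->
  forall u, mdist (tensor_map f u) (tensor_map g u) <= 2^-1 * c.
Proof.
move=> fpt gpt fg u; have [m [x ->]] := tens_surj u.
rewrite !tensor_mapE// mdist_tens tpd_same.
by rewrite ler_pM2l ?invr_gt0.
Qed.

Lemma cvg_tens X m (u : nat -> X) (x : X) :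
  u n @[n --> \oo] --> x -> (tens m (u n) : tensor X) @[n --> \oo] --> tens m x.
Proof.
move=> /cvg_seqP ux; apply/(@cvg_seqP _ (tensor X)) => e e0.
have [N hN] := ux e e0; exists N => n /hN; rewrite mdist_tens tpd_same => h.
by have := mdist_ge0 x (u n); lra.
Qed.

(** Points of the tensor close to p lie in a cell that contains p, and are
    close to p inside this cell.  A path to a cell that does not contain p has
    a piece of positive length bounded below independently of its target, and
    there are finitely many cells.  The radius r z may depend on the point z
    that represents p in the cell. *)
Lemma near_tens X (r : X -> R) (p : tensor X) : (forall x, 0 < r x) ->
  exists2 d : R, 0 < d & forall q : tensor X, mdist p q < d ->
    exists m x y, [/\ p = tens m x, q = tens m y & mdist x y < r x].
Proof.
move=> r0; have [m [x ->]] := tens_surj p.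
(* The admissible distance for a target q in cell n. *)
pose b (n : 'I_i) : R :=
  if n == m then 2^-1 * r x
  else if x == pt X n then Num.min 2^-1 (2^-1 * r (pt X m))
  else Num.min 2^-1 (2^-1 * mdist x (pt X n)).
have b0 n : 0 < b n.
  have half (a : R) : 0 < a -> 0 < 2^-1 * a.
    by move=> ?; rewrite mulr_gt0 ?invr_gt0.
  rewrite /b; case: ifP => _; first exact: half.
  case: eqVneq => xn; rewrite lt_min invr_gt0 ltr0n/=; apply: half => //.
  rewrite lt_neqAle mdist_ge0 andbT eq_sym; apply: contra_neq xn.
  exact: mdist_positivity.
exists (\big[Num.min/1]_n b n) => [|q].
  by apply/lt_bigmin.
have [n [y ->]] := tens_surj q.
move=> /lt_le_trans /(_ (bigmin_le_cond 1 b (isT : xpredT n))).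
rewrite /b mdist_tens; have [->|nm] := eqVneq n m.
  rewrite tpd_same ltr_pM2l ?invr_gt0// => xy.
  by exists m, x, y.
have mn : m != n by rewrite eq_sym.
case: (tpdP x y mn) => [|k km kn]; last first.
  have := mdist_ge0 x (pt X k); have := mdist_ge0 (pt X k) y.
  by case: ifP => _; rewrite lt_min => ? ? /andP[]; lra.
have := mdist_ge0 x (pt X n); have := mdist_ge0 (pt X m) y.
case: eqVneq => [->|_] ? ?; rewrite lt_min => /andP[_ h].
  exists n, (pt X m), y; split => //; first exact: tens_glue.
  by move: h; rewrite mdistxx; lra.
by lra.
Qed.

End TensorEstimates.

(** * Solutions of the co-algebra equation *)

Section Solutions.
Context {R : realType} {i : nat} (X Y : pointedMetric R i).
Variables (e : X -> tensor X) (p : Y -> tensor Y).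
Hypothesis p_iso : isometric p.

Definition solution (f : X -> Y) := preserves_pt f /\ p \o f = tensor_map f \o e.

Lemma mdist_solution f x y : solution f ->
  mdist (f x) (f y) = mdist (tensor_map f (e x)) (tensor_map f (e y)).
Proof.
by move=> [_ fE]; rewrite -p_iso -!/((tensor_map f \o e) _) -fE.
Qed.

Lemma solution_unique f g : solution f -> solution g -> f = g.
Proof.
move=> [fpt fE] [gpt gE].
have h n x : mdist (f x) (g x) <= 2^-1 ^+ n.
  elim: n x => [|n IH] x; first exact: pm_le1.
  rewrite -p_iso exprS.
  rewrite -[p (f x)]/((p \o f) x) fE -[p (g x)]/((p \o g) x) gE.
  exact: mdist_tensor_map_le.
apply/funext => x; apply/mdist_positivity/eqP; rewrite eq_le mdist_ge0 andbT.
by apply: le_half_pow => n; rewrite add0r.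
Qed.

Lemma exists_solution : preserves_pt p -> (forall u, exists y, p y = u) ->
  seq_complete Y -> preserves_pt e -> exists f, solution f.
Proof.
move=> p_pt p_surj Yc ept.
have [q qK] := choice p_surj.
have p_inj y z : p y = p z -> y = z.
  by move=> yz; apply: mdist_positivity; rewrite -p_iso yz mdistxx.
pose Phi (f : X -> Y) : X -> Y := q \o tensor_map f \o e.
have Phi_pt f : preserves_pt f -> preserves_pt (Phi f).
  move=> fpt j; apply: p_inj.
  by rewrite /Phi /= qK ept p_pt preserves_pt_tensor_map.
have Phi_half f g c : preserves_pt f -> preserves_pt g ->
    (forall x, mdist (f x) (g x) <= c) ->
    forall x, mdist (Phi f x) (Phi g x) <= 2^-1 * c.
  by move=> fpt gpt fg x; rewrite -p_iso /Phi /= !qK; exact: mdist_tensor_map_le.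
(* The starting point of the iteration sends x to a distinguished point; for
   x not itself distinguished, the cell of e x provides an index. *)
have [f0 f0pt] : exists f0 : X -> Y, preserves_pt f0.
  have h x : exists y : Y, forall j, x = pt X j -> y = pt Y j.
    have [[j ->]|nx] := pselect (exists j, x = pt X j).
      exists (pt Y j) => k jk; have [->//|/(@pm_pt _ _ X)] := eqVneq j k.
      by rewrite jk mdistxx => /eqP; rewrite eq_sym oner_eq0.
    have [m _] := tens_surj (e x).
    by exists (pt Y m) => j xj; case: nx; exists j.
  have [f0 hf0] := choice h.
  by exists f0 => j; exact: hf0.
pose F n := iter n Phi f0.
have F_pt n : preserves_pt (F n) by elim: n => //= n; exact: Phi_pt.
have F_close n k x : mdist (F n x) (F (n + k)%N x) <= 2^-1 ^+ n.
  elim: n x => [|n IH] x; first exact: pm_le1.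
  by rewrite addSn exprS; exact: Phi_half.
have F_cvg x : exists y : Y, F n x @[n --> \oo] --> y.
  apply: Yc; apply/cauchy_seqP => c c0.
  have [|N hN] := @half_pow_lt R (c / 2); first by rewrite divr_gt0.
  exists N => m n Nm Nn.
  have := metric_triangle (F m x) (F N x) (F n x).
  rewrite (metric_sym (F m x) (F N x)).
  by have := F_close N (m - N)%N x; have := F_close N (n - N)%N x;
    rewrite !subnKC//; lra.
have [f hf] := choice F_cvg.
have f_close n x : mdist (f x) (F n x) <= 2^-1 ^+ n.
  apply/ler_addgt0Pr => c c0.
  have [N /(_ (n + N)%N (leq_addl _ _)) h] := proj1 (cvg_seqP _ _) (hf x) c c0.
  have := metric_triangle (f x) (F (n + N)%N x) (F n x).
  by rewrite (metric_sym (F (n + N)%N x)); have := F_close n N x; lra.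
have fpt : preserves_pt f.
  move=> j; apply/mdist_positivity/eqP; rewrite eq_le mdist_ge0 andbT.
  by apply: le_half_pow => n; rewrite add0r -(F_pt n j).
exists f; split=> //; apply/funext => x.
rewrite /= -[RHS]qK; congr p; rewrite -/(Phi f x).
apply/mdist_positivity/eqP; rewrite eq_le mdist_ge0 andbT.
apply: le_half_pow => n; rewrite add0r.
have := metric_triangle (f x) (F n.+1 x) (Phi f x).
have : mdist (F n.+1 x) (Phi f x) <= 2^-1 * 2^-1 ^+ n.
  by rewrite metric_sym; apply: Phi_half.
by have := f_close n.+1 x; rewrite exprS; lra.
Qed.

(** Each unfolding of e halves the excess: on a path from a cell to a
    distinguished point in another cell, the last piece has length 1 both in X
    and in Y. *)
Lemma solution_pt_le f : short_hom e -> solution f ->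
  forall x j, mdist (f x) (pt Y j) <= mdist x (pt X j).
Proof.
move=> [ept e_short] fs x j; have fpt := fs.1.
apply: le_half_pow => n; elim: n x j => [|n IH] x j.
  by have := pm_le1 (f x) (pt Y j); have := mdist_ge0 x (pt X j); lra.
have n0 := @half_pow_ge0 R n.
apply: le_trans (_ : mdist (e x) (pt (tensor X) j) + 2^-1 ^+ n.+1 <= _); last first.
  by have := e_short x (pt X j); rewrite ept; lra.
rewrite -(fpt j) mdist_solution// ept exprS.
have [m [z ->]] := tens_surj (e x).
rewrite !tensor_mapE// fpt mdist_tens.
have [<-|mj] := eqVneq m j.
  rewrite mdist_tens !tpd_same.
  by have := IH z m; lra.
rewrite [X in _ <= X + _]mdist_tens; case: (tpdP z (pt X j) mj) => [|k km kj].
  have := tpd_direct (f z) (pt Y j) mj; rewrite (pm_pt X mj) (pm_pt Y mj).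
  by have := IH z j; lra.
have := tpd_via (f z) (pt Y j) mj km kj; rewrite (pm_pt X kj) (pm_pt Y kj).
by have := IH z k; lra.
Qed.

(** Only pairs of points in one cell have an excess to be halved; paths between
    different cells are made of pieces ending at distinguished points. *)
Lemma solution_short f : short_hom e -> solution f -> short_hom f.
Proof.
move=> eh fs; have [fpt _] := fs; split=> // x y.
have f_pt_le := solution_pt_le eh fs; have [_ e_short] := eh.
apply: le_half_pow => n; elim: n x y => [|n IH] x y.
  by have := pm_le1 (f x) (f y); have := mdist_ge0 x y; lra.
have n0 := @half_pow_ge0 R n.
apply: le_trans (_ : mdist (e x) (e y) + 2^-1 ^+ n.+1 <= _); last first.
  by have := e_short x y; lra.
rewrite mdist_solution// exprS.
have [m [z ->]] := tens_surj (e x); have [j [w ->]] := tens_surj (e y).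
rewrite !tensor_mapE// !mdist_tens.
have [<-|mj] := eqVneq m j.
  rewrite !tpd_same.
  by have := IH z w; lra.
case: (tpdP z w mj) => [|k km kj].
  have := tpd_direct (f z) (f w) mj.
  have := f_pt_le z j; have := f_pt_le w m.
  by rewrite (metric_sym w) (metric_sym (f w)); lra.
have := tpd_via (f z) (f w) mj km kj.
have := f_pt_le z k; have := f_pt_le w k.
by rewrite (metric_sym w) (metric_sym (f w)); lra.
Qed.

(** If every x has a radius within which f varies by at most c, so it does for
    c / 2: by [near_tens], near x both e x and e y lie in one cell, and within
    the radius attached to a representative of e x. *)
Lemma solution_continuous f : continuous e -> solution f -> continuous f.
Proof.
move=> ec fs; have [fpt _] := fs.
have osc n : exists r : X -> R, (forall x, 0 < r x) /\
    forall x y, mdist x y < r x -> mdist (f x) (f y) <= 2^-1 ^+ n.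
  elim: n => [|n [r [r0 hr]]].
    by exists (fun=> 1); split=> // x y _; exact: pm_le1.
  suff h x : exists d : R, 0 < d /\
      forall y, mdist x y < d -> mdist (f x) (f y) <= 2^-1 ^+ n.+1.
    have [d hd] := choice h.
    by exists d; split=> [x|x y]; [exact: (hd x).1|exact: (hd x).2].
  have [c c0 hc] := near_tens (e x) r0.
  have /metricType_numDomainType.cvgrPdist_lt /(_ c c0) := ec x.
  move=> /metricType_numDomainType.nbhs_mdistP[d /= d0 hd].
  exists d; split=> // y xy.
  have [m [z [w [xE yE zw]]]] := hc (e y) (hd y xy).
  rewrite mdist_solution// xE yE !tensor_mapE// mdist_tens tpd_same exprS.
  by rewrite ler_pM2l ?invr_gt0//; exact: hr.
move=> x; apply/metricType_numDomainType.cvgrPdist_lt => c c0.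
have [n nc] := half_pow_lt c0.
have [r [r0 hr]] := osc n.
apply/metricType_numDomainType.nbhs_mdistP.
exists (r x) => [|y xy]; first exact: r0.
exact: le_lt_trans (hr _ _ xy) nc.
Qed.

End Solutions.

(** * The structure map of S *)

Section Psi.
Variables (R : realType) (i : nat).
Local Notation psi := (@psi R i).
Local Notation S := (Sspace R i).

Lemma psi_preserves_pt : preserves_pt psi.
Proof.
move=> j; have jE : pt S j = G_to_S (g_map (pt (tensor (Gspace R i)) j)).
  by rewrite g_map_pt.
by rewrite jE psi_extends preserves_pt_tensor_map.
Qed.

Lemma psi_isometric : isometric psi.
Proof.
move=> s t; have [u _ us] := completion_dense s; have [v _ vt] := completion_dense t.
have psi_us := continuous_cvg _ (@psi_continuous R i s) us.
have psi_vt := continuous_cvg _ (@psi_continuous R i t) vt.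
apply: (mdist_limit_eq _ (psi_us _) (psi_vt _) us vt) => n.
have [w <-] := g_map_surj (u n); have [w' <-] := g_map_surj (v n).
rewrite -!/(G_to_S _) !psi_extends.
rewrite (isometric_tensor_map (@G_to_S_pt R i) (@G_to_S_iso R i)).
by rewrite [RHS]G_to_S_iso g_map_iso.
Qed.

(** Lift a sequence of G converging to s to the sequence of the points m (x) u n,
    which converges to a preimage of m (x) s by completeness of S. *)
Lemma psi_surj u : exists s, psi s = u.
Proof.
have [m [s ->]] := tens_surj u.
have [v cv vs] := completion_dense s.
pose w n : Gspace R i := g_map (tens m (v n)).
have psi_w n : psi (G_to_S (w n)) = tens m (G_to_S (v n)).
  by rewrite psi_extends tensor_mapE.
have [|t wt] := completion_complete (u := fun n => G_to_S (w n)).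
  apply/(@cauchy_seqP _ S) => e e0.
  have [N hN] := proj1 (cauchy_seqP v) cv e e0.
  exists N => k n Nk Nn; rewrite [ltLHS]G_to_S_iso g_map_iso mdist_tens tpd_same.
  by have := hN k n Nk Nn; have := mdist_ge0 (v k) (v n); lra.
exists t; have psi_wt := continuous_cvg _ (@psi_continuous R i t) wt.
have tens_vs := @cvg_tens R i S m _ _ vs.
apply/mdist_positivity; rewrite -(mdistxx (psi t)).
by apply: (mdist_limit_eq _ (psi_wt _) tens_vs (psi_wt _) (psi_wt _)) => n; rewrite psi_w.
Qed.

(** Existence and uniqueness do not depend on the class of morphisms, so S is
    final as soon as morphism structures have morphisms as solutions. *)
Lemma psi_final (hom : forall X Y : pointedMetric R i, (X -> Y) -> Prop) :
  (forall (X Y : pointedMetric R i) (f : X -> Y), hom X Y f -> preserves_pt f) ->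
  hom S (tensor S) psi ->
  (forall (X : pointedMetric R i) (e : X -> tensor X) f, hom X (tensor X) e ->
     solution e psi f -> hom X S f) ->
  is_final_coalgebra hom psi.
Proof.
move=> hom_pt psi_hom sol_hom; split=> // X e eh.
have [f fs] := exists_solution psi_isometric psi_preserves_pt psi_surj
  (completion_complete (X := Gspace R i)) (hom_pt _ _ _ eh).
exists f; split=> [|g [gh gE]]; first by split; [exact: sol_hom fs|exact: fs.2].
apply: (solution_unique psi_isometric fs); split=> //.
exact: hom_pt gh.
Qed.

End Psi.

Theorem proposition3 (R : realType) (i : nat) (hi : i = 2%N \/ i = 3%N) :
  is_final_coalgebra (@short_hom R i) (@psi R i) /\
  is_final_coalgebra (@continuous_hom R i) (@psi R i).
Proof.
split; apply: psi_final.
- by move=> X Y f [].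
- by split=> [|x y]; [exact: psi_preserves_pt|rewrite psi_isometric].
- by move=> X e f; exact: (solution_short (@psi_isometric R i)).
- by move=> X Y f [].
- by split; [exact: psi_preserves_pt|exact: psi_continuous].
- move=> X e f [_ ec] fs; split; first exact: fs.1.
  exact: (solution_continuous (@psi_isometric R i) ec fs).
Qed.
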